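(* Let $n\ge 1$ be an integer and let $r\ge 0$ be an integer with $r<\log_2 n$. The parameterized family of games get-close-to-the-target (with parameter $k\in\{1,2,\ldots,n\}$ unknown to player 1) is guaranteed approximately BL-WoLF-learnable with loss $r$ and precision $1-\frac{2^{r}}{n}$.
   Context: Stage game. There are two players, player 1 (the learner) and player 2 (the opponent), with finite action sets $A_1, A_2$. Each pair of actions determines (deterministically, or through a probability distribution) a pair of utilities; the game is zero-sum (the utilities sum to a constant). A stage-game strategy for player $i$ is a probability distribution over $A_i$. The value $V$ of the game is $V=\max_{\sigma_1}\min_{\sigma_2}E[u_1\mid\sigma_1,\sigma_2]$. A strategy $\sigma_1$ is an $\epsilon$-approximate maximin strategy for player 1 if it guarantees player 1 expected utility at least $V-\epsilon$ against every $\sigma_2$. Repeated game. A parameterized family of stage games consists of fixed action sets $A_1,A_2$, a parameter set $K$, and a map sending each $k\in K$ to a zero-sum stage game with these action sets. One $k \in K$ is fixed, and the corresponding stage game is played over and over. Player 2 knows $k$ and player 1's learning strategy; player 1 knows only the family. After each round player 1 observes both actions and the payoffs. A learning strategy for player 1 prescribes a stage-game strategy for each history of past actions and payoffs; the opponent may likewise use any history-dependent strategy. Player 1's loss in a round is $V$ (the value of the actual stage game) minus the utility player 1 received in that round; the loss incurred over several rounds is the sum of the losses of those rounds. Guaranteed approximate BL-WoLF-learnability. A parameter value is consistent with a history if that history's observed payoffs are possible under it given the actions. Player 1 has learned enough to construct an $\epsilon$-approximate maximin strategy once there is a single stage-game strategy of player 1 that is an $\epsilon$-approximate maximin strategy in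 every game of the family consistent with the history so far. A family is guaranteed approximately BL-WoLF-learnable with loss $l$ and precision $\epsilon$ if there exists a learning strategy for player 1 such that, for any game in the family and against any opponent, the cumulative loss incurred by player 1 before learning enough about the game to construct an $\epsilon$-approximate maximin strategy (that is, at any time up to and including the round in which this is learned, or at all times if it is never learned) is never more than $l$. The family get-close-to-the-target. For given $n$ (known to both players), both players have action set $\{1,2,\ldots,n\}$. The outcome is determined by a parameter $k\in\{1,\ldots,n\}$. Given actions $a_1,a_2$ (and writing $-i$ for the player other than $i$): if $|a_i-k|<|a_{-i}-k|$, player $i$ wins; if $a_1=a_2=a\neq k$, player 1 wins if $a<k$ and player 2 wins if $a>k$; otherwise (i.e. $a_1-k=k-a_2$) there is a draw. Winning gives utility $1$, losing gives utility $-1$, a draw gives utility $0$ to both. Player 1 initially does not know $k$. *)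

(* Defs.v *)
From mathcomp Require Import all_boot all_order all_algebra.
From mathcomp Require Import all_classical all_reals all_analysis.

Set Implicit Arguments.
Unset Strict Implicit.
Unset Printing Implicit Defensive.

Import Order.TTheory GRing.Theory Num.Theory.
Local Open Scope classical_set_scope.
Local Open Scope ring_scope.

Record strategy (R : realType) (A : finType) := Strategy {
  prob :> A -> R;
  prob_ge0 : forall a, 0 <= prob a;
  prob_sum1 : \sum_a prob a = 1
}.

(* [payoff a1 a2] is the pair (utility of player 1, utility of player 2). *)
Record game (R : realType) (A1 A2 : finType) := Game {
  payoff :> A1 -> A2 -> R * R;
  zero_sum : exists c : R, forall a1 a2,
    (payoff a1 a2).1 + (payoff a1 a2).2 = c
}.

Section StageGame.
Variables (R : realType) (A1 A2 : finType).
Implicit Type G : game R A1 A2.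

Definition expected_u1 G (s1 : strategy R A1) (s2 : strategy R A2) : R :=
  \sum_a1 \sum_a2 s1 a1 * s2 a2 * (G a1 a2).1.

(* max over s1 of min over s2: on the compact simplices of mixed strategies
   the sup and the inf are attained. *)
Definition value G : R :=
  sup [set inf [set expected_u1 G s1 s2 | s2 in [set: strategy R A2]]
      | s1 in [set: strategy R A1]].

Definition approx_maximin G (eps : R) (s1 : strategy R A1) : Prop :=
  forall s2 : strategy R A2, value G - eps <= expected_u1 G s1 s2.

End StageGame.

Section RepeatedGame.
Variables (R : realType) (A1 A2 : finType).

(* Rounds (a1, a2, (u1, u2)) in chronological order. *)
Definition history := seq (A1 * A2 * (R * R)).

Definition learning_strategy := history -> strategy R A1.
Definition opponent_strategy := history -> strategy R A2.

(* [occurs G sigma tau h]: the history h has positive probability when G is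
   played repeatedly with sigma against tau. *)
Inductive occurs (G : game R A1 A2) (sigma : learning_strategy)
    (tau : opponent_strategy) : history -> Prop :=
| occurs_nil : occurs G sigma tau [::]
| occurs_rcons h a1 a2 :
    occurs G sigma tau h -> 0 < sigma h a1 -> 0 < tau h a2 ->
    occurs G sigma tau (rcons h (a1, a2, G a1 a2)).

Definition loss (G : game R A1 A2) (h : history) : R :=
  \sum_(x <- h) (value G - x.2.1).

Variables (K : Type) (F : K -> game R A1 A2).

Definition consistent (h : history) (k : K) : Prop :=
  forall a1 a2 u, (a1, a2, u) \in h -> F k a1 a2 = u.

Definition learned (eps : R) (h : history) : Prop :=
  exists s1 : strategy R A1,
    forall k, consistent h k -> approx_maximin (F k) eps s1.

(* A history counts as long as nothing had been learned before its last round,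
   so the round in which player 1 learns enough is itself counted. The opponent
   strategy is quantified after sigma and k: the opponent knows both. *)
Definition guaranteed_approx_BL_WoLF_learnable (l eps : R) : Prop :=
  exists sigma : learning_strategy,
    forall (k : K) (tau : opponent_strategy) (h : history),
      occurs (F k) sigma tau h ->
      (forall m, (m < size h)%N -> ~ learned eps (take m h)) ->
      loss (F k) h <= l.

End RepeatedGame.

Section GetCloseToTheTarget.
Variables (R : realType) (n : nat).

(* The ordinal i : 'I_n stands for the integer i + 1 of {1, ..., n}; the rules
   only involve distances and comparisons, which the shift preserves. *)
Definition dist (a k : 'I_n) : nat := `|(a : int) - (k : int)|%N.

Definition target_payoff (k a1 a2 : 'I_n) : R * R :=
  if (dist a1 k < dist a2 k)%N then (1, -1)
  else if (dist a2 k < dist a1 k)%N then (-1, 1)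
  else if (a1 == a2) && (a1 != k) then
    if (a1 < k)%N then (1, -1) else (-1, 1)
  else (0, 0).

Lemma target_zero_sum (k : 'I_n) : exists c : R, forall a1 a2,
  (target_payoff k a1 a2).1 + (target_payoff k a1 a2).2 = c.
Proof.
exists 0 => a1 a2; rewrite /target_payoff.
by do ![case: ifP => _ /=]; rewrite ?subrr ?addNr ?addr0.
Qed.

Definition get_close_to_the_target (k : 'I_n) : game R 'I_n 'I_n :=
  Game (target_zero_sum k).

End GetCloseToTheTarget.

Definition log2 (R : realType) (x : R) : R := ln x / ln 2.

(* Main.v *)
Require Import Defs.
From mathcomp Require Import all_boot all_order all_algebra.
From mathcomp Require Import all_classical all_reals all_analysis.
From mathcomp Require Import zify lra.

Set Implicit Arguments.
Unset Strict Implicit.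
Unset Printing Implicit Defensive.

Import Order.TTheory GRing.Theory Num.Theory.
Local Open Scope ring_scope.

(** Every game of the family has value 0, since playing k guarantees each player
a draw. Player 1 plays a median of the set of parameters consistent with the
history. A lost round reveals on which side of player 1's action k lies, so it
at least halves that set; after r lost rounds at most n / 2^r candidates remain,
and mixing uniformly over them hits k with probability at least 2^r / n, which
guarantees -1 + 2^r / n. *)

Section Strategies.
Variables (R : realType) (A : finType).

Lemma dirac_strategy_sum1 (b : A) : \sum_a ((a == b)%:R : R) = 1.
Proof.
rewrite (bigD1 b) //= eqxx big1 ?addr0 // => i /negbTE ->.
by [].
Qed.

Definition dirac_strategy (b : A) : strategy R A :=
  Strategy (fun a => ler0n R (a == b)) (dirac_strategy_sum1 b).

Lemma dirac_strategy_support (a b : A) : 0 < dirac_strategy b a -> a = b.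
Proof. by rewrite /= ltr0n lt0b => /eqP. Qed.

Lemma uniform_strategy_ge0 (C : {set A}) a : 0 <= (a \in C)%:R / #|C|%:R :> R.
Proof. by rewrite divr_ge0. Qed.

Lemma uniform_strategy_sum1 (C : {set A}) :
  (0 < #|C|)%N -> \sum_a ((a \in C)%:R / #|C|%:R : R) = 1.
Proof.
move=> C_gt0; rewrite -mulr_suml -natr_sum.
have -> : (\sum_a (a \in C) = #|C|)%N.
  by rewrite -sum1_card [RHS]big_mkcond; apply: eq_bigr => a _; case: (a \in C).
by rewrite divff // pnatr_eq0 -lt0n.
Qed.

End Strategies.

Section TargetGame.
Variables (R : realType) (n : nat).
Local Notation F := (@get_close_to_the_target R n).

(** At the target player 1 never loses, and elsewhere the payoff is at least -1. Using the indicator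
    of [a1 == k] makes this one bound that can be averaged over mixed strategies. *)
Lemma target_payoff_ge (k a1 a2 : 'I_n) :
  (a1 == k)%:R - 1 <= (F k a1 a2).1.
Proof.
rewrite /= /target_payoff /dist.
case: (eqVneq a1 k) => [->|_]; last by do ![case: ifP => _ /=]; lra.
case: ifP => _ /=; first lra.
case: ifP => [|_]; first lia.
by rewrite andbF /= subrr.
Qed.

Lemma target_payoff_target_le0 (k a1 : 'I_n) : (F k a1 k).1 <= 0.
Proof.
rewrite /= /target_payoff /dist.
case: ifP => [|_]; first lia.
case: ifP => _ /=; first lra.
by case: (eqVneq a1 k).
Qed.

(** After a loss with distinct actions, [k] is nearer to [a2], hence on the side of [a1] where [a2]
    lies. With equal actions player 1 loses only above the target, so the tie joins the case
    [a2 <= a1]. The side thus depends on the actions alone. *)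
Lemma target_payoff_lt0 (k a1 a2 : 'I_n) : (F k a1 a2).1 < 0 ->
  if (a2 <= a1)%N then (k < a1)%N else (a1 < k)%N.
Proof.
rewrite /= /target_payoff /dist.
case: ifP => [_|lt12] /=; first lra.
case: ifP => [lt21 _|ge21]; first by case: ifP; lia.
case: ifP => [/andP[/eqP-> neq]|_] /=; last lra.
rewrite leqnn; case: ifP => [_|le _] /=; first lra.
by move: neq; rewrite -val_eqE /=; lia.
Qed.

Lemma expected_target_ge (k : 'I_n) (s1 s2 : strategy R 'I_n) :
  s1 k - 1 <= expected_u1 (F k) s1 s2.
Proof.
have -> : s1 k - 1 =
    \sum_a1 \sum_a2 s1 a1 * s2 a2 * ((a1 == k)%:R - 1).
  under eq_bigr => a1 _ do
    rewrite -mulr_suml -mulr_sumr prob_sum1 mulr1 mulrBr mulr1.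
  rewrite sumrB prob_sum1 (bigD1 k) //= eqxx mulr1 big1 ?addr0 //.
  by move=> i /negbTE ->; rewrite mulr0.
apply: ler_sum => a1 _; apply: ler_sum => a2 _.
by rewrite ler_wpM2l ?target_payoff_ge// mulr_ge0 ?prob_ge0.
Qed.

Lemma expected_target_dirac_le0 (k : 'I_n) (s1 : strategy R 'I_n) :
  expected_u1 (F k) s1 (dirac_strategy R k) <= 0.
Proof.
apply: sumr_le0 => a1 _; apply: sumr_le0 => a2 _.
case: (eqVneq a2 k) => [->|/negbTE nk]; last first.
  by rewrite /= nk mulr0 mul0r.
by rewrite mulr_ge0_le0 ?target_payoff_target_le0// mulr_ge0 ?prob_ge0.
Qed.

Lemma value_target (k : 'I_n) : value (F k) = 0.
Proof.
rewrite /value; set S := (X in sup X).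
have S_ub : ubound S 0.
  move=> _ [s1 _ <-]; apply: le_trans (expected_target_dirac_le0 k s1).
  apply: ge_inf; last by exists (dirac_strategy R k).
  (* [ge_inf] needs a lower bound of the set; -1 is the worst payoff. *)
  exists (-1) => _ [s2 _ <-]; apply: le_trans (expected_target_ge k s1 s2).
  by have := prob_ge0 s1 k; lra.
apply/eqP; rewrite eq_le; apply/andP; split.
  by apply: ge_sup => //; eexists; exists (dirac_strategy R k).
apply: (@le_trans _ _
  (inf [set expected_u1 (F k) (dirac_strategy R k) s2 | s2 in setT]%classic)).
  apply: lb_le_inf; first by eexists; exists (dirac_strategy R k).
  move=> _ [s2 _ <-].
  by have := expected_target_ge k (dirac_strategy R k) s2; rewrite /= eqxx subrr.
apply: ub_le_sup; first by exists 0.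
by exists (dirac_strategy R k).
Qed.

Lemma loss_target (k : 'I_n) (h : history R 'I_n 'I_n) :
  loss (F k) h = - \sum_(x <- h) x.2.1.
Proof.
by rewrite -sumrN; apply: eq_bigr => x _; rewrite value_target sub0r.
Qed.

(** Boolean counterpart of [consistent], as a finite set whose cardinality measures what is still
    unknown. *)
Definition candidates (h : history R 'I_n 'I_n) : {set 'I_n} :=
  [set k | all (fun x => F k x.1.1 x.1.2 == x.2) h].

Lemma candidatesP (h : history R 'I_n 'I_n) k :
  reflect (consistent F h k) (k \in candidates h).
Proof.
rewrite inE; apply: (iffP allP) => [hk a1 a2 u /hk /eqP //|hk].
by move=> [[a1 a2] u] /hk /eqP.
Qed.

Lemma candidates_rcons h a1 a2 u :
  candidates (rcons h (a1, a2, u)) =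
  [set k in candidates h | F k a1 a2 == u].
Proof. by apply/setP => k; rewrite !inE all_rcons andbC. Qed.

Lemma learned_candidates (h : history R 'I_n 'I_n) (eps : R) :
  (0 < #|candidates h|)%N -> 1 - #|candidates h|%:R^-1 <= eps ->
  learned F eps h.
Proof.
move=> C_gt0 eps_ge.
exists (Strategy (uniform_strategy_ge0 R (candidates h))
                 (uniform_strategy_sum1 R C_gt0)) => k /candidatesP kC s2.
apply: le_trans (expected_target_ge _ _ _).
by rewrite value_target /= kC mul1r; lra.
Qed.

(** Take the least [t] with at least half of [C] at or below it: at most half is left above, and
    minimality leaves at most half strictly below. *)
Lemma exists_median (C : {set 'I_n}) : (0 < n)%N ->
  exists a : 'I_n, (#|[set x in C | (x < a)%N]|.*2 <= #|C|)%N /\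
                   (#|[set x in C | (a < x)%N]|.*2 <= #|C|)%N.
Proof.
move=> n_gt0.
pose P t := (#|C| <= #|[set x in C | (x <= t)%N]|.*2)%N.
have Pn : P n.-1.
  rewrite /P; have -> : [set x in C | (x <= n.-1)%N] = C; last lia.
  by apply/setP => x; rewrite inE; have := ltn_ord x; case: (x \in C); lia.
have [t Pt t_min] := ex_minnP (ex_intro P _ Pn).
have tn : (t < n)%N by have := t_min _ Pn; lia.
exists (Ordinal tn); split=> /=.
  case: t Pt t_min tn => [|t] Pt t_min tn.
    by rewrite eq_card0 // => x; rewrite !inE andbF.
  (* Here the median is [t.+1], and lying strictly below it means lying at or below [t]. *)
  have : ~~ P t by apply/negP => /t_min; lia.
  by rewrite /P -ltnNge => /ltnW.
have := cardsID [set x : 'I_n | (x <= t)%N] C.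
have -> : C :&: [set x : 'I_n | (x <= t)%N] = [set x in C | (x <= t)%N].
  by apply/setP => x; rewrite !inE.
have -> : C :\: [set x : 'I_n | (x <= t)%N] = [set x in C | (t < x)%N].
  by apply/setP => x; rewrite !inE -ltnNge andbC.
by move: Pt; rewrite /P; move: #|_| #|[set x in C | (t < x)%N]| #|C|; lia.
Qed.

Definition lost_rounds (h : history R 'I_n 'I_n) : nat :=
  count (fun x => x.2.1 < 0) h.

Section Play.
Variables (sigma : learning_strategy R 'I_n 'I_n).
Variables (tau : opponent_strategy R 'I_n 'I_n) (k : 'I_n).

Lemma occurs_candidate h : occurs (F k) sigma tau h -> k \in candidates h.
Proof.
elim=> [|{}h a1 a2 _ IH _ _]; first by rewrite inE.
by rewrite candidates_rcons inE IH eqxx.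
Qed.

(** The value being 0, a lost round costs at most 1 and any other round costs at most 0. *)
Lemma occurs_loss_le h :
  occurs (F k) sigma tau h -> loss (F k) h <= (lost_rounds h)%:R.
Proof.
rewrite loss_target; elim=> [|{}h a1 a2 _ IH _ _].
  by rewrite big_nil oppr0.
rewrite -cats1 big_cat big_seq1 /lost_rounds count_cat natrD opprD.
apply: lerD => //; rewrite [count _ [:: _]]/= addn0.
case: ltP => [_|u_ge0]; last by rewrite oppr_le0.
by have := target_payoff_ge k a1 a2; have := ler0n R (a1 == k); cbn; lra.
Qed.

(** [exists_median] yields a median for each set separately; the main proof obtains this function by
    [choice]. *)
Variable median : {set 'I_n} -> 'I_n.
Hypothesis medianP : forall C : {set 'I_n},
  (#|[set x in C | (x < median C)%N]|.*2 <= #|C|)%N /\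
  (#|[set x in C | (median C < x)%N]|.*2 <= #|C|)%N.
Hypothesis sigmaE : forall h,
  sigma h = dirac_strategy R (median (candidates h)).

Lemma card_candidates_le h : occurs (F k) sigma tau h ->
  (2 ^ lost_rounds h * #|candidates h| <= n)%N.
Proof.
elim=> [|{}h a1 a2 _ IH sa1 _].
  by rewrite mul1n -[leqRHS]card_ord max_card.
move: sa1; rewrite sigmaE => /dirac_strategy_support a1E.
rewrite candidates_rcons /lost_rounds -cats1 count_cat.
rewrite [count _ [:: _]]/= addn0 -/(lost_rounds h).
set C' := [set _ in _ | _].
have [lost|_] := ltP; last first.
  rewrite addn0; apply: leq_trans IH; rewrite leq_mul2l subset_leq_card ?orbT//.
  by apply/fintype.subsetP => x; rewrite inE => /andP[].
suff C'_half : (#|C'|.*2 <= #|candidates h|)%N.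
  by apply: leq_trans IH; rewrite expnD expn1 -mulnA leq_mul2l mul2n C'_half orbT.
have [below above] := medianP (candidates h).
(* A surviving candidate predicts the same negative payoff, so all survivors lie on the same side of
   the median [a1]. *)
have side x : x \in C' -> if (a2 <= a1)%N then (x < a1)%N else (a1 < x)%N.
  rewrite inE => /andP[_ /eqP xE]; apply: target_payoff_lt0.
  by rewrite xE.
have C'_sub (Q : pred 'I_n) : (forall x, x \in C' -> Q x) ->
    (#|C'| <= #|[set x in candidates h | Q x]|)%N.
  move=> Q_C'; apply/subset_leq_card/fintype.subsetP => x xC'.
  by rewrite inE Q_C' // andbT; move: xC'; rewrite inE => /andP[].
rewrite -a1E in below above.
case: (a2 <= a1)%N side => side.
- by apply: leq_trans below; rewrite leq_double C'_sub.
- by apply: leq_trans above; rewrite leq_double C'_sub.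
Qed.

Lemma occurs_learned h r : occurs (F k) sigma tau h ->
  (r <= lost_rounds h)%N -> learned F (1 - 2%:R ^+ r / n%:R) h.
Proof.
move=> occ r_le.
have C_gt0 : (0 < #|candidates h|)%N.
  by apply/card_gt0P; exists k; exact: occurs_candidate occ.
have C_le : (2 ^ r * #|candidates h| <= n)%N.
  by apply: leq_trans (card_candidates_le occ); rewrite leq_mul2r leq_exp2l ?r_le ?orbT.
apply: learned_candidates => //; rewrite lerD2l lerN2.
have n_gt0 : 0 < n%:R :> R by rewrite ltr0n; have := ltn_ord k; lia.
by rewrite ler_pdivrMr // mulrC ler_pdivlMr ?ltr0n // -natrX -natrM ler_nat.
Qed.

End Play.
End TargetGame.

Theorem theorem5 (R : realType) (n r : nat) (hn : (1 <= n)%N)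
    (hr : r%:R < log2 (n%:R : R)) :
  guaranteed_approx_BL_WoLF_learnable (@get_close_to_the_target R n)
    r%:R (1 - 2%:R ^+ r / n%:R).
Proof.
have [median medianP] := choice (fun C : {set 'I_n} => exists_median C hn).
exists (fun h => dirac_strategy R (median (candidates h))) => k tau h occ.
move=> not_learned.
apply: le_trans (occurs_loss_le occ) _; rewrite ler_nat.
(* Nothing was learned before the last round, so fewer than [r] rounds were lost by then; the last
   round adds at most one. *)
case: h / occ not_learned => [//|h a1 a2 occ _ _] not_learned.
have {}not_learned : ~ learned (@get_close_to_the_target R n)
    (1 - 2%:R ^+ r / n%:R) h.
  have := not_learned (size h); rewrite size_rcons ltnSn -cats1 take_size_cat //.
  exact.
have : ~~ (r <= lost_rounds h)%N.
  apply/negP => r_le; apply: not_learned.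
  exact: (occurs_learned medianP (fun=> erefl) occ).
by rewrite /lost_rounds -cats1 count_cat /=; case: (_ < _); lia.
Qed.
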